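(* Let $p$ be a prime and let $G \simeq C_{n_1} \oplus \dots \oplus C_{n_r}$ be a finite abelian $p$-group, where $1 < n_1 \mid n_2 \mid \dots \mid n_r$. If $S$ is a zero-sumfree sequence in $G$ with $|S| \geq \mathsf{d}(G)-p+2$, then $n_1$ divides $\mathrm{ord}_G(g)$ for every term $g$ of $S$.
   Context: $C_n$ denotes the cyclic group of order $n$. A sequence in $G$ is a finite unordered list of elements with repetition allowed; $|S|$ is its length counted with multiplicity. A sequence is zero-sumfree if no nonempty subsequence has sum $0$. $\mathsf{d}(G)$ is the maximal length of a zero-sumfree sequence in $G$. $\mathrm{ord}_G(g)$ is the order of $g$ in $G$. *)

(* Defs.v *)
From HB Require Import structures.
From mathcomp Require Import all_boot all_order all_algebra.
From mathcomp Require Import all_fingroup all_solvable.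

Set Implicit Arguments.
Unset Strict Implicit.
Unset Printing Implicit Defensive.

Import GRing.Theory.

Local Open Scope ring_scope.

(* Sequences over G are unordered with repetition allowed; they are represented
   by lists, and everything below depends on the list only up to permutation.
   A subsequence is selected by a set of positions, so that multiplicities are
   respected. *)
Definition zero_sumfree (G : finZmodType) (S : seq G) : bool :=
  [forall I : {set 'I_(size S)}, (I != set0) ==> (\sum_(i in I) S`_i != 0)].

Lemma zero_sumfree_nil (G : finZmodType) : zero_sumfree ([::] : seq G).
Proof. by apply/forallP=> I; apply/implyP=> /set0Pn[[]]. Qed.

Lemma zero_sumfree_size (G : finZmodType) (S : seq G) :
  zero_sumfree S -> (size S < #|G|)%N.
Proof.
move=> /forallP zS.
pose f (i : 'I_(size S).+1) := \sum_(j < size S | (j < i)%N) S`_j.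
suff f_inj : injective f by rewrite -[X in (X <= _)%N]card_ord; exact: leq_card f_inj.
suff f_lt (i j : 'I_(size S).+1) : (i < j)%N -> f i <> f j.
  move=> i j eq_f; apply/val_inj; case: (ltngtP i j) => // lt_ij.
    by case: (f_lt _ _ lt_ij).
  by case: (f_lt _ _ lt_ij).
move=> lt_ij eq_f; have lt_iS : (i < size S)%N by apply: leq_trans lt_ij _; rewrite -ltnS.
have /implyP := zS [set k : 'I_(size S) | (i <= k < j)%N].
case/(_ _)/negP.
  by apply/set0Pn; exists (Ordinal lt_iS); rewrite inE /= leqnn.
have : f j = f i + \sum_(k in [set k : 'I_(size S) | (i <= k < j)%N]) S`_k.
  rewrite /f (bigID (fun k : 'I_(size S) => (k < i)%N)) /=; congr (_ + _).
    apply: eq_bigl => k; apply: andb_idl => lt_ki; exact: ltn_trans lt_ij.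
  by apply: eq_bigl => k; rewrite inE -leqNgt andbC.
by rewrite -eq_f -{1}[f i]addr0 => /addrI <-.
Qed.

Definition has_zero_sumfree (G : finZmodType) (k : nat) : bool :=
  [exists t : k.-tuple G, zero_sumfree t].

Lemma has_zero_sumfreeP (G : finZmodType) (k : nat) :
  reflect (exists2 S : seq G, zero_sumfree S & size S = k)
          (has_zero_sumfree G k).
Proof.
apply: (iffP existsP) => [[t zt]|[S zS <-]]; last by exists (in_tuple S).
by exists (val t) => //; exact: size_tuple.
Qed.

Lemma has_zero_sumfree_ex (G : finZmodType) : exists k, has_zero_sumfree G k.
Proof.
by exists 0%N; apply/has_zero_sumfreeP; exists [::] => //; exact: zero_sumfree_nil.
Qed.

Lemma has_zero_sumfree_ub (G : finZmodType) (k : nat) :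
  has_zero_sumfree G k -> (k <= #|G|)%N.
Proof. by case/has_zero_sumfreeP=> S zS <-; apply/ltnW/zero_sumfree_size. Qed.

(* d(G), the maximal length of a zero-sumfree sequence in G; this is one less
   than the Davenport constant D(G). *)
Definition small_davenport (G : finZmodType) : nat :=
  ex_maxn (@has_zero_sumfree_ex G) (@has_zero_sumfree_ub G).

Lemma small_davenport_attained (G : finZmodType) :
  exists2 S : seq G, zero_sumfree S & size S = small_davenport G.
Proof.
by apply/has_zero_sumfreeP; rewrite /small_davenport; case: ex_maxnP.
Qed.

Lemma small_davenport_max (G : finZmodType) (S : seq G) :
  zero_sumfree S -> (size S <= small_davenport G)%N.
Proof.
move=> zS; rewrite /small_davenport; case: ex_maxnP => d _; apply.
by apply/has_zero_sumfreeP; exists S.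
Qed.

(* Main.v *)
Require Import Defs.
From HB Require Import structures.
From mathcomp Require Import all_boot all_order all_algebra.
From mathcomp Require Import all_fingroup all_solvable.

Set Implicit Arguments.
Unset Strict Implicit.
Unset Printing Implicit Defensive.

(* In the group algebra F_p[G], a zero-sumfree sequence S gives
   prod_(x in S) (1 - X^x) != 0, since the coefficient at 0 is 1. On the other
   hand any product of more than D = sum_i (n_i - 1) factors 1 - X^x vanishes:
   each factor lies in the ideal spanned by the 1 - X^(e_i), for a basis (e_i)
   of G, and (1 - X^(e_i))^(n_i) = 0. If n_1 does not divide ord(g), then
   g = p h for some h, so that 1 - X^g = (1 - X^h)^p: a term g of this kind
   counts for p factors, and the product has at least
   |S| - 1 + p > d(G) >= D factors. *)

Import GRing.Theory FinRing.Theory.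

Local Open Scope ring_scope.

(** * The group algebra and products of nilpotent combinations *)

Lemma exprBn_pchar (A : comNzRingType) (x y : A) q :
  [pchar A].-nat q -> (x - y) ^+ q = x ^+ q - y ^+ q.
Proof.
by move=> pq; apply/eqP; rewrite eq_sym subr_eq -exprDn_pchar // subrK.
Qed.

(* An alias of the function type, whose own ring structure is pointwise: here
   the product is the convolution. *)
Definition group_algebra (R : comNzRingType) (G : finZmodType) : Type :=
  {ffun G -> R}.

HB.instance Definition _ (R : comNzRingType) (G : finZmodType) :=
  GRing.Zmodule.copy (group_algebra R G) {ffun G -> R}.

Section GroupAlgebra.

Variables (R : comNzRingType) (G : finZmodType).

Local Notation RG := (group_algebra R G).

Implicit Types (f g h : RG) (x y : G).

Definition ga_monomial x : RG := [ffun y => (y == x)%:R].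

Definition ga_mul f g : RG := [ffun x => \sum_y f y * g (x - y)].

Fact ga_mulC : commutative ga_mul.
Proof.
move=> f g; apply/ffunP=> x; rewrite !ffunE (reindex_inj (inv_inj (subKr x))).
by apply: eq_bigr => y _; rewrite subKr mulrC.
Qed.

Fact ga_mulA : associative ga_mul.
Proof.
move=> f g h; apply/ffunP=> x; rewrite !ffunE.
under eq_bigr do rewrite ffunE mulr_sumr.
under [RHS]eq_bigr do rewrite ffunE mulr_suml.
rewrite [RHS]exchange_big; apply: eq_bigr => y _ /=.
rewrite [RHS](reindex_inj (addrI y)) /=; apply: eq_bigr => z _.
by rewrite [y + z - y]addrAC subrr add0r mulrA opprD addrA.
Qed.

Fact ga_mul1 : left_id (ga_monomial 0) ga_mul.
Proof.
move=> f; apply/ffunP=> x; rewrite ffunE (bigD1 0) //= big1 => [|y /negPf y0].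
  by rewrite ffunE eqxx mul1r subr0 addr0.
by rewrite ffunE y0 mul0r.
Qed.

Fact ga_mulDl : left_distributive ga_mul +%R.
Proof.
move=> f g h; apply/ffunP=> x; rewrite !ffunE -big_split.
by apply: eq_bigr => y _; rewrite !ffunE mulrDl.
Qed.

Fact ga_monomial0_neq0 : ga_monomial 0 != 0.
Proof.
by apply/eqP=> /ffunP/(_ 0)/eqP; rewrite !ffunE eqxx oner_eq0.
Qed.

HB.instance Definition _ := GRing.Zmodule_isComNzRing.Build RG
  ga_mulA ga_mulC ga_mul1 ga_mulDl ga_monomial0_neq0.

Lemma ga_oneE : 1 = ga_monomial 0 :> RG. Proof. by []. Qed.

Lemma ga_monomialD x y : ga_monomial (x + y) = ga_monomial x * ga_monomial y.
Proof.
apply/ffunP=> z; rewrite !ffunE (bigD1 x) //= big1 => [|t /negPf tx].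
  by rewrite !ffunE eqxx mul1r addr0 subr_eq addrC.
by rewrite ffunE tx mul0r.
Qed.

Lemma ga_monomialMn x k : ga_monomial (x *+ k) = ga_monomial x ^+ k.
Proof.
by elim: k => [|k IHk]; rewrite ?mulr0n ?expr0 // mulrS exprS ga_monomialD IHk.
Qed.

Lemma ga_monomial_sum (I : finType) (A : {set I}) (x : I -> G) :
  ga_monomial (\sum_(i in A) x i) = \prod_(i in A) ga_monomial (x i).
Proof. exact: (big_morph _ ga_monomialD). Qed.

Lemma pchar_group_algebra p : p \in [pchar R] -> p \in [pchar RG].
Proof.
case/andP=> p_pr /eqP p0; rewrite inE p_pr /=; apply/eqP/ffunP=> x.
by rewrite ffunMnE ga_oneE !ffunE mulrnAC p0 mul0rn.
Qed.

(* Every nonempty subset sum being nonzero, only the constant term of the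
   expanded product contributes at 0. *)
Lemma zero_sumfree_prod_coef0 (S : seq G) : zero_sumfree S ->
  (\prod_(x <- S) (1 - ga_monomial x)) 0 = 1.
Proof.
move=> /forallP zS; rewrite (big_nth 0) big_mkord.
have -> : \prod_(i < size S) (1 - ga_monomial S`_i)
    = \sum_(J in {set 'I_(size S)})
        (-1) ^+ #|J| * ga_monomial (\sum_(i in J) S`_i).
  under eq_bigr do rewrite addrC.
  rewrite (bigA_distr _ _ (fun i : 'I_(size S) => - ga_monomial S`_i)).
  apply: eq_bigr => J _ /=.
  by rewrite ga_monomial_sum -prodrN [RHS]big_mkcond.
rewrite sum_ffunE (bigD1 set0) //= [X in _ + X]big1 => [|J J0].
  by rewrite cards0 expr0 mul1r big_set0 ffunE eqxx addr0.
(* The sign lives in the group algebra and acts by convolution; passing to parity leaves [1] or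
   [-1], after which evaluation at [0] is direct. *)
rewrite -signr_odd; have /implyP/(_ J0)/negPf := zS J.
by rewrite eq_sym => sJ; case: odd; rewrite ?mulN1r ?mul1r !ffunE sJ ?oppr0.
Qed.

End GroupAlgebra.

(** Pigeonhole: the product expands into monomials in the [y i] of total degree [size s], so in each
    of them some exponent reaches [n i]. *)
Lemma prod_nilpotent_comb (A : comNzRingType) (I : finType) (y : I -> A)
    (n : I -> nat) (s : seq A) :
    (forall i, y i ^+ n i = 0) ->
    (forall x, x \in s -> exists b : I -> A, x = \sum_i b i * y i) ->
  (\sum_i (n i).-1 < size s)%N -> \prod_(x <- s) x = 0.
Proof.
move=> y_nil.
(* For the induction on [s], a monomial with exponents [c] collects the factors already expanded;
   [size s + \sum_i c i] stays constant. *)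
suff main (c : I -> nat) :
    (forall x, x \in s -> exists b, x = \sum_i b i * y i) ->
    (\sum_i (n i).-1 < size s + \sum_i c i)%N ->
    \prod_i y i ^+ c i * \prod_(x <- s) x = 0.
  move=> sP lt_s; have := main (fun=> 0%N) sP; rewrite big1_eq addn0.
  by move=> /(_ lt_s); rewrite big1 ?mul1r.
elim: s c => [|x s IHs] c sP lt_c.
  have [i le_nc|lt_cn] := pickP (fun i => (n i <= c i)%N).
    by rewrite (bigD1 i) //= -(subnKC le_nc) exprD y_nil !mul0r.
  move: lt_c; rewrite add0n ltnNge leq_sum // => i _.
  have := lt_cn i; rewrite leqNgt => /negbFE; case: (n i) => //.
have [b ->] := sP x (mem_head _ _).
rewrite big_cons mulr_suml mulr_sumr big1 // => i _.
rewrite -mulrA mulrCA [X in _ * X]mulrA.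
have -> : \prod_i0 y i0 ^+ c i0 * y i = \prod_j y j ^+ (c j + (j == i)).
  rewrite (bigD1 i) //= [RHS](bigD1 i) //= eqxx addn1 exprSr mulrAC.
  by congr (_ * _); apply: eq_bigr => j /negPf->; rewrite addn0.
rewrite IHs ?mulr0 // => [z zs|]; first by apply: sP; rewrite inE zs orbT.
have -> : (\sum_j (c j + (j == i)) = (\sum_j c j).+1)%N.
  rewrite big_split /= [X in (_ + X)%N](bigD1 i) //= eqxx.
  by rewrite [X in (1 + X)%N]big1 ?addn1 // => j /negPf->.
by rewrite addnS -addSn.
Qed.

(** * Bases of a finite abelian group and the two bounds they yield *)

Definition zmod_basis (G : finZmodType) (I : finType) (n : I -> nat)
    (e : I -> G) : Prop :=
  (forall x, exists a : I -> nat, x = \sum_i e i *+ a i) /\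
  (forall a : I -> nat, \sum_i e i *+ a i = 0 <-> forall i, (n i %| a i)%N).

Lemma isog_setXn_Zp_basis (G : finZmodType) (I : finType) (n : I -> nat) :
    (forall i, 1 < n i)%N ->
    ([set: G] \isog setXn (fun i => [set: 'Z_(n i)]))%g ->
  exists e : I -> G, zmod_basis n e.
Proof.
move=> n_gt1 /isogP[f /injmP f_inj f_im].
have fD x y i : f (x + y) i = f x i + f y i :> 'Z_(n i).
  by rewrite -zmodMgE morphM ?inE // !ffunE.
have f0 i : f 0 i = 0 :> 'Z_(n i).
  by apply: (addrI (f 0 i : 'Z_(n i))); rewrite -fD !addr0.
have f_onto v : exists x, f x = v.
  have : v \in (f @* setT)%g by rewrite f_im; apply/setXnP=> i; rewrite inE.
  by case/morphimP=> x _ _ ->; exists x.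
(* The basis consists of the preimages of the unit vectors. *)
have [e eE] : exists e : I -> G,
    forall i j, f (e i) j = (i == j)%:R :> 'Z_(n j).
  pose P i x := forall j, f x j = (i == j)%:R :> 'Z_(n j).
  apply: (fin_all_exists (P := P)).
  move=> i; have [x xE] := f_onto [ffun j => (i == j)%:R : 'Z_(n j)].
  by exists x => j; rewrite xE ffunE.
have fMn x k i : f (x *+ k) i = f x i *+ k :> 'Z_(n i).
  by elim: k => [|k IHk]; rewrite ?mulr0n // !mulrS fD IHk.
have fcomb (a : I -> nat) j : f (\sum_i e i *+ a i) j = (a j)%:R :> 'Z_(n j).
  rewrite (big_morph (fun x => f x j : 'Z_(n j)) (fun x y => fD x y j) (f0 j)).
  rewrite (bigD1 j) //= fMn eE eqxx big1 ?addr0 // => i /negPf ij.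
  by rewrite fMn eE ij mul0rn.
exists e; split=> [x|a].
  exists (fun i => f x i : nat); apply: f_inj; rewrite ?inE //.
  by apply/ffunP=> i; rewrite fcomb natr_Zp.
(* Here [1 < n i] matters: by convention ['Z_0] and ['Z_1] have two elements. *)
have aE i : ((a i)%:R == 0 :> 'Z_(n i)) = (n i %| a i)%N.
  by rewrite -(inj_eq val_inj) /= val_Zp_nat.
split=> [a0 i|na]; first by rewrite -aE -fcomb a0 f0.
apply: f_inj; rewrite ?inE //.
by apply/ffunP=> i; rewrite fcomb f0; apply/eqP; rewrite aE.
Qed.

Lemma small_davenport_ge_card (G : finZmodType) (J : finType) (x : J -> G) :
    (forall A : {set J}, A != set0 -> \sum_(j in A) x j != 0) ->
  (#|J| <= small_davenport G)%N.
Proof.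
move=> xP; rewrite -(size_codom x); apply: small_davenport_max.
have szJ : size (codom x) = #|J| by rewrite size_codom.
apply/forallP=> A; apply/implyP=> A0.
pose h (i : 'I_(size (codom x))) : J := enum_val (cast_ord szJ i).
have h_inj : injective h by move=> i j /enum_val_inj/cast_ord_inj.
have -> : \sum_(i in A) (codom x)`_i = \sum_(j in h @: A) x j.
  rewrite big_imset /=; last by move=> i j _ _; exact: h_inj.
  by apply: eq_bigr => i _; rewrite /h -[in RHS](nth_codom 0).
by apply: xP; rewrite imset_eq0.
Qed.

Section Basis.

Variables (G : finZmodType) (I : finType) (n : I -> nat) (e : I -> G).
Hypothesis e_basis : zmod_basis n e.

Lemma basis_sum_delta i k : \sum_j e j *+ (if j == i then k else 0%N) = e i *+ k.
Proof.
by rewrite (bigD1 i) //= eqxx big1 ?addr0 // => j /negPf->; rewrite mulr0n.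
Qed.

Lemma basis_mulrn_eq0 i k : (e i *+ k == 0) = (n i %| k)%N.
Proof.
rewrite -basis_sum_delta; have [_ eP] := e_basis.
apply/eqP/idP=> [/eP/(_ i)|nk]; first by rewrite eqxx.
by apply/eP=> j; case: eqP => // ->.
Qed.

(** The sequence with [n i - 1] copies of each [e i] is zero-sumfree: a subsequence takes
    [c i < n i] copies of [e i], so a zero sum forces every [c i] to be 0. *)
Lemma small_davenport_ge_basis :
  (forall i, 0 < n i)%N -> (\sum_i (n i).-1 <= small_davenport G)%N.
Proof.
move=> n_gt0; have [_ eP] := e_basis.
(* [J] indexes the copies; the tag tells which [e i] is copied. *)
pose J : finType := {i : I & 'I_(n i).-1}.
have <- : #|J| = (\sum_i (n i).-1)%N.
  rewrite card_tagged sumnE big_map big_enum.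
  by apply: eq_bigr => i _; rewrite card_ord.
apply: (@small_davenport_ge_card _ _ (fun j : J => e (tag j))) => A A0.
pose c i := #|[set j in A | tag j == i]|.
have -> : \sum_(j in A) e (tag j) = \sum_i e i *+ c i.
  rewrite (partition_big (fun j : J => tag j) predT) //=; apply: eq_bigr => i _.
  rewrite -sumr_const; apply: eq_big => [j|j /andP[_ /eqP->] //].
  by rewrite inE.
apply: contra A0 => /eqP/eP n_c; apply/eqP/setP=> j; rewrite inE.
apply/negP=> Aj; have := n_c (tag j).
have c_gt0 : (0 < c (tag j))%N.
  by apply/card_gt0P; exists j; rewrite inE Aj eqxx.
have c_lt : (c (tag j) < n (tag j))%N.
  rewrite -(ltn_predK (n_gt0 (tag j))) ltnS -[leqRHS]card_ord.
  pose F k : J := Tagged (fun i => 'I_(n i).-1) (k : 'I_(n (tag j)).-1).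
  apply: leq_trans (leq_imset_card F _).
  apply: subset_leq_card; apply/subsetP=> -[i k].
  rewrite inE /= => /andP[_ /eqP ik].
  by subst i; apply: (imset_f F).
by move/(dvdn_leq c_gt0); rewrite leqNgt c_lt.
Qed.

(** The elements [x] with this property are closed under addition, since 1 - X^(y+z) = (1 - X^y) +
    X^y (1 - X^z). *)
Lemma basis_augmentation (R : comNzRingType) (x : G) :
  exists b : I -> group_algebra R G,
    1 - ga_monomial R x = \sum_i b i * (1 - ga_monomial R (e i)).
Proof.
pose P x := exists b : I -> group_algebra R G,
  1 - ga_monomial R x = \sum_i b i * (1 - ga_monomial R (e i)).
have P0 : P 0.
  by exists (fun=> 0); rewrite subrr big1 // => i _; rewrite mul0r.
have PD y z : P y -> P z -> P (y + z).
  case=> [b bE] [c cE]; exists (fun i => b i + ga_monomial R y * c i).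
  under eq_bigr do rewrite mulrDl -mulrA.
  by rewrite big_split /= -mulr_sumr -bE -cE ga_monomialD mulrBr mulr1 addrA subrK.
have Pe i : P (e i).
  exists (fun j => (j == i)%:R); rewrite (bigD1 i) //= eqxx mul1r big1 ?addr0 //.
  by move=> j /negPf->; rewrite mul0r.
have [/(_ x)[a ->] _] := e_basis.
apply: (big_ind P) => // i _; elim: (a i) => // k; rewrite mulrS; exact: PD.
Qed.

Lemma prod_augmentation_eq0 (R : comNzRingType) p (s : seq G) :
    p \in [pchar R] -> (forall i, p.-nat (n i)) ->
    (\sum_i (n i).-1 < size s)%N ->
  \prod_(x <- s) (1 - ga_monomial R x) = 0.
Proof.
move=> pR pn lt_s; rewrite -(big_map (fun x => 1 - ga_monomial R x) xpredT id).
apply: (@prod_nilpotent_comb _ _ (fun i => 1 - ga_monomial R (e i)) n).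
- move=> i; have pA := pchar_group_algebra G pR.
  (* Since [n i] is a power of [p], Frobenius gives (1 - X^(e i))^(n i) = 1 - X^(n i e i), which is
     0. *)
  rewrite exprBn_pchar; last by rewrite (eq_pnat _ (pcharf_eq pA)).
  have /eqP e0 : e i *+ n i == 0 by rewrite basis_mulrn_eq0.
  by rewrite expr1n -ga_monomialMn e0 subrr.
- by move=> _ /mapP[x _ ->]; exact: basis_augmentation.
- by rewrite size_map.
Qed.

End Basis.

Local Close Scope ring_scope.

(** * A term divisible by [p] counts [p] times *)

Theorem theorem5p2 (p : nat) (G : finZmodType) (r : nat)
    (n : 'I_r.+1 -> nat) (S : seq G)
    (p_prime : prime p)
    (pG : (p.-group [set: G])%g)
    (n_gt1 : forall i : 'I_r.+1, 1 < n i)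
    (n_dvd : forall i j : 'I_r.+1, j = i.+1 :> nat -> n i %| n j)
    (isoG : ([set: G] \isog setXn (fun i : 'I_r.+1 => [set: 'Z_(n i)]))%g)
    (zsfS : zero_sumfree S)
    (sizeS : small_davenport G + 2 <= size S + p) :
  forall g : G, g \in S -> n ord0 %| #[g]%g.
Proof.
have n_pos i : 0 < n i by exact: ltnW.
have [e e_basis] := isog_setXn_Zp_basis n_gt1 isoG.
(* [n i] divides the order of [G], which annihilates [e i]. *)
have pn i : p.-nat (n i).
  apply: pnat_dvd pG; rewrite -(basis_mulrn_eq0 e_basis) -zmodXgE.
  by rewrite expg_cardG ?inE.
have n0_dvd i : n ord0 %| n i.
  case: i => i; elim: i => [|i IHi] lt_ir.
    by rewrite (_ : ord0 = Ordinal lt_ir) //; exact: val_inj.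
  exact: dvdn_trans (IHi (ltnW lt_ir)) (n_dvd (Ordinal (ltnW lt_ir)) _ _).
move=> g gS; apply: contraT => n0_ndvd.
have [h gE] : exists h : G, g = (h *+ p)%R.
  have [gen e0P] := e_basis; have [a gE] := gen g.
  have [k n0E] := p_natP (pn ord0).
  have [l gl] := p_natP (mem_p_elt pG (in_setT g)).
  have lt_lk : l < k.
    by move: n0_ndvd; rewrite n0E gl dvdn_Pexp2l ?prime_gt1 // -ltnNge.
  (* As p^l g = 0, [n i], and hence p^k, divides [a i * p ^ l]; with l < k this leaves a factor [p]
     in [a i]. *)
  have p_dvd_a i : p %| a i.
    have : n i %| a i * p ^ l.
      move: i; apply/e0P; under eq_bigr do rewrite mulrnA.
      by rewrite sumrMnl -gE -gl -zmodXgE expg_order.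
    move/(dvdn_trans (n0_dvd i)); rewrite n0E -(subnKC lt_lk) addSnnS expnD mulnC.
    rewrite dvdn_pmul2r ?expn_gt0 ?prime_gt0 //; apply: dvdn_trans.
    by rewrite expnS dvdn_mulr.
  exists (\sum_i e i *+ (a i %/ p))%R; rewrite gE -sumrMnl.
  by apply: eq_bigr => i _; rewrite -mulrnA divnK.
have pF : p \in [pchar 'F_p]%R by exact: pchar_Fp.
have := zero_sumfree_prod_coef0 'F_p zsfS.
(* The factor of [g] becomes [p] factors of [h], by Frobenius. *)
have -> : (\prod_(x <- S) (1 - ga_monomial 'F_p x)
    = \prod_(x <- nseq p h ++ rem g S) (1 - ga_monomial 'F_p x))%R.
  rewrite (perm_big _ (perm_to_rem gS)) big_cons big_cat big_nseq /=.
  rewrite -Monoid.iteropE; congr (_ * _)%R; rewrite gE ga_monomialMn.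
  rewrite -{1}(expr1n _ p) -exprBn_pchar //.
  by rewrite (eq_pnat _ (pcharf_eq (pchar_group_algebra G pF))) pnat_id.
rewrite (prod_augmentation_eq0 e_basis pF) // => [/eqP|].
  by rewrite ffunE eq_sym oner_eq0.
rewrite size_cat size_nseq size_rem //.
apply: leq_ltn_trans (small_davenport_ge_basis e_basis n_pos) _.
(* Removing [g] leaves [(size S).-1] terms; since [S] is nonempty this predecessor is not truncated,
   and [sizeS] gives the strict bound. *)
have : 0 < size S by case: (S) gS.
by case: (size S) sizeS => // m; rewrite addSn addn2 ltnS addnC.
Qed.
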